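(* $z_L(5,3)=9$.
   Context: **Classical Zarankiewicz number.** For $m\ge n\ge 2$, $z(m,n)$ is the maximum number of edges in a bipartite graph with parts $S=[m]=\{1,\dots,m\}$ and $T=[n]=\{1,\dots,n\}$ that contains no $K_{2,2}$ (equivalently, no cycle $C_4$). **Limited augmented bipartite graphs.** Let $G_1=(S,T,E_1)$ with $S=[m]$, $T=[n]$ be a $C_4$-free bipartite graph with $|E_1|=z(m,n)$. A limited augmented bipartite graph $G=(S,T,E_1\cup E_2)$ augmented from $G_1$ consists of the set $E_1$ of 1-edges (pairs, or ''cells'', $(i,j)\in S\times T$) and a set $E_2$ of 2-edges. A 2-edge is a quadruple $(i,j;k,l)$ with $i,k\in S$, $j,l\in T$, where the case $i=k$ and $j=l$ is forbidden; it is regarded as an unordered pair of the two distinct cells $(i,j)$ and $(k,l)$, called its halves. It is nondegenerate if $i\ne k$ and $j\ne l$, row-degenerate if $i=k$ and $j\neq l$, and column-degenerate if $i\ne k$ and $j=l$. The simplicity condition is imposed: no 2-edge shares a cell with any 1-edge or with another 2-edge. **Generalized $C_4$-cycles.** A cell $(i,j)$ is occupied if $(i,j)\in E_1$ or $(i,j)$ is a half of some 2-edge in $E_2$. The graph $G$ contains a generalized $C_4$-cycle if any of the following holds: 1. There is a classical $C_4$-cycle formed by 1-edges. 2. There is a nondegenerate 2-edge $(i,j;k,l)\in E_2$ such that both cells $(i,l)$ and $(k,j)$ are occupied. 3. There are a 2-edge $(i,j;p,q)\in E_2$ (of any type) and a cell $(k,l)$ with $k\notin\{i,p\}$ and $l\notin\{j,q\}$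 such that the five cells $(k,l),(k,j),(k,q),(i,l),(p,l)$ are all occupied; if the 2-edge is nondegenerate, these five cells must moreover be pairwise distinct. **Limited augmented Zarankiewicz number.** $z_L(m,n)$ is the maximum of $|E_1|+|E_2|$ over all $m\times n$ limited augmented bipartite graphs $G=(S,T,E_1\cup E_2)$ (augmented from a $C_4$-free graph with $|E_1|=z(m,n)$, satisfying the simplicity condition) that contain no generalized $C_4$-cycle. *)

(* Defs.v *)
From mathcomp Require Import all_boot.

Set Implicit Arguments.
Unset Strict Implicit.
Unset Printing Implicit Defensive.

(* The cell (i, j) joins i in S = [m] and j in T = [n]; vertices
   are numbered from 0. *)
Notation cell m n := ('I_m * 'I_n)%type.

Section Zarankiewicz.

Variables m n : nat.

Definition has_C4 (E : {set cell m n}) : bool :=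
  [exists i : 'I_m, exists k : 'I_m, exists j : 'I_n, exists l : 'I_n,
    [&& i != k, j != l,
        (i, j) \in E, (i, l) \in E, (k, j) \in E & (k, l) \in E]].

Definition zarankiewicz : nat :=
  \max_(E : {set cell m n} | ~~ has_C4 E) #|E|.

(* The 2-edge (i,j;k,l) is the unordered pair [set (i, j); (k, l)]; having
   cardinal 2 excludes exactly the forbidden case i = k and j = l. *)
Definition is_two_edge (e : {set cell m n}) : bool := #|e| == 2.

Definition nondegenerate (c d : cell m n) : bool :=
  (c.1 != d.1) && (c.2 != d.2).

(* trivIset: distinct 2-edges share no cell. *)
Definition simple_augmentation
    (E1 : {set cell m n}) (E2 : {set {set cell m n}}) : bool :=
  [disjoint E1 & cover E2] && trivIset E2.

Definition limited_augmented
    (E1 : {set cell m n}) (E2 : {set {set cell m n}}) : bool :=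
  [&& ~~ has_C4 E1, #|E1| == zarankiewicz,
      [forall e in E2, is_two_edge e] & simple_augmentation E1 E2].

Definition occupied
    (E1 : {set cell m n}) (E2 : {set {set cell m n}}) : {set cell m n} :=
  E1 :|: cover E2.

Definition has_type2_cycle
    (E1 : {set cell m n}) (E2 : {set {set cell m n}}) : bool :=
  [exists i : 'I_m, exists j : 'I_n, exists k : 'I_m, exists l : 'I_n,
    [&& [set (i, j); (k, l)] \in E2, nondegenerate (i, j) (k, l),
        (i, l) \in occupied E1 E2 & (k, j) \in occupied E1 E2]].

Definition has_type3_cycle
    (E1 : {set cell m n}) (E2 : {set {set cell m n}}) : bool :=
  [exists i : 'I_m, exists j : 'I_n, exists p : 'I_m, exists q : 'I_n,
   exists k : 'I_m, exists l : 'I_n,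
    let five := [:: (k, l); (k, j); (k, q); (i, l); (p, l)] in
    [&& [set (i, j); (p, q)] \in E2,
        k \notin [:: i; p], l \notin [:: j; q],
        all (fun c => c \in occupied E1 E2) five
      & nondegenerate (i, j) (p, q) ==> uniq five]].

Definition has_generalized_C4
    (E1 : {set cell m n}) (E2 : {set {set cell m n}}) : bool :=
  [|| has_C4 E1, has_type2_cycle E1 E2 | has_type3_cycle E1 E2].

Definition limited_zarankiewicz : nat :=
  \max_(G : {set cell m n} * {set {set cell m n}}
        | limited_augmented G.1 G.2 && ~~ has_generalized_C4 G.1 G.2)
    (#|G.1| + #|G.2|).

End Zarankiewicz.

(* Main.v *)
Require Import Defs.
From mathcomp Require Import all_boot.
From mathcomp Require Import zify.

Set Implicit Arguments.
Unset Strict Implicit.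
Unset Printing Implicit Defensive.

(** Write d_i for the number of 1-edges in row i.  A C4-free E1 has
    sum_i 'C(d_i, 2) <= 'C(n, 2), because every pair of columns is joined by at
    most one row; since d <= 1 + 'C(d, 2), with equality exactly for d = 1 and
    d = 2, this gives |E1| <= m + 'C(n, 2), and it determines the equality case
    ([leqif_card_C4_free]).  For m = 5 and n = 3 the bound 8 is attained.  So an
    optimal E1 has three heavy rows, with two 1-edges and one empty cell each,
    and two light rows, with one 1-edge and two empty cells each; moreover any
    two columns are joined by some row.

    One 2-edge can be added: if it consists of the two empty cells of a light
    row, then a generalized C4 would need a second row occupied in every column,
    and there is none ([row_edge_augmentation]).

    Two 2-edges cannot be added ([card_E2_le1]).  Two observations do the work.
    - A 2-edge cannot have its halves in one column if its two rows share
      another occupied column, because some heavy row joins these two columns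
      and closes a cycle of type 3 ([no_column_pair]).
    - A row that is occupied in all columns, or full, kills every 2-edge that
      avoids it, has halves in different columns, and has its rows occupied in
      the third column ([no_type3_full]).
    The first of these and the type 2 condition rule out a 2-edge with both
    halves in heavy rows.  The remaining 2-edges are mixed (one heavy and one
    light half), inside a light row, or across the two light rows.  A mixed
    2-edge fills its heavy row, so it excludes another mixed 2-edge and any
    2-edge inside a light row.  The light row it uses has its other empty cell
    unoccupied, so it also excludes 2-edges across.  A 2-edge inside a light row
    fills that row, which excludes one inside the other light row and leaves no
    room for one across.  Two 2-edges across fill both light rows, and each then
    lies in a cycle of type 2 or 3. *)

(** * Extremal C4-free graphs with m + 'C(n, 2) edges *)

Section Extremal.

Variables m n : nat.
Implicit Types (E : {set cell m n}) (B : {set 'I_n}).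

Definition row E (i : 'I_m) : {set 'I_n} := [set j | (i, j) \in E].

Definition joining_rows E B : {set 'I_m} := [set i | B \subset row E i].

Lemma C4_free_joining E i k j l :
    ~~ has_C4 E -> j != l -> (i, j) \in E -> (i, l) \in E ->
  (k, j) \in E -> (k, l) \in E -> i = k.
Proof.
move=> noC4 jl ij il kj kl; apply/eqP; apply: contraNT noC4 => ik.
apply/existsP; exists i; apply/existsP; exists k.
by apply/existsP; exists j; apply/existsP; exists l; rewrite ik jl ij il kj kl.
Qed.

Lemma card_rows E : #|E| = \sum_i #|row E i|.
Proof.
under eq_bigr do rewrite -sum1dep_card.
by rewrite pair_big_dep -sum1_card; apply: eq_bigl => -[i j].
Qed.

Lemma leqif_bin2 d : d <= 1 + 'C(d, 2) ?= iff (0 < d < 3).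
Proof.
case: d => [|[|[|d]]]; try by split.
have bin_pos : 0 < 'C(d.+2, 2) by rewrite bin_gt0.
by rewrite binS bin1; split; lia.
Qed.

(** Double counting of the incidences between rows and the pairs of columns that
    they join. *)
Lemma sum_bin2_rows E :
  \sum_i 'C(#|row E i|, 2) = \sum_(B : {set 'I_n} | #|B| == 2) #|joining_rows E B|.
Proof.
under eq_bigr do rewrite -cards_draws -sum1dep_card.
under [RHS]eq_bigr do rewrite -sum1dep_card.
rewrite (exchange_big_dep (fun B => #|B| == 2)) /=; last by move=> i B _ /andP[].
by apply: eq_bigr => B B2; apply: eq_bigl => i; rewrite B2 andbT.
Qed.

Lemma card_joining_rows E B : ~~ has_C4 E -> #|B| == 2 -> #|joining_rows E B| <= 1.
Proof.
move=> noC4 /cards2P[j [l [jl ->]]]; apply/card_le1_eqP => i k.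
rewrite !inE !subUset !sub1set !inE => /andP[ij il] /andP[kj kl].
exact: C4_free_joining noC4 jl kj kl ij il.
Qed.

(** The equality case carries the structure of extremal graphs.  It is tight when
    d_i <= 1 + 'C(d_i, 2) is an equality in every row and every pair of columns
    is joined by exactly one row. *)
Lemma leqif_card_C4_free E : ~~ has_C4 E ->
  #|E| <= m + 'C(n, 2)
    ?= iff [forall i, 0 < #|row E i| < 3]
           && [forall (B : {set 'I_n} | #|B| == 2), #|joining_rows E B| == 1].
Proof.
move=> noC4; rewrite card_rows.
apply: (@leqif_trans _ (\sum_i (1 + 'C(#|row E i|, 2)))).
  by apply: leqif_sum => i _; apply: leqif_bin2.
rewrite big_split /= sum1_card card_ord sum_bin2_rows.
have -> : 'C(n, 2) = \sum_(B : {set 'I_n} | #|B| == 2) 1.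
  by rewrite sum1dep_card card_draws card_ord.
rewrite (mono_leqif (leq_add2l _)).
by apply: leqif_sum => B B2; split=> //; apply: card_joining_rows.
Qed.

Definition light E i := #|row E i| == 1.

Section ExtremalRows.

Variable E : {set cell m n}.
Hypotheses (noC4 : ~~ has_C4 E) (maxE : #|E| = m + 'C(n, 2)).

Lemma extremal_row_size i : 0 < #|row E i| < 3.
Proof.
have /leqif_card_C4_free[_] := noC4.
by rewrite maxE eqxx => /esym/andP[/forallP].
Qed.

Lemma extremal_joined j l :
  j != l -> exists k, ((k, j) \in E) && ((k, l) \in E).
Proof.
move=> jl; have /leqif_card_C4_free[_] := noC4.
rewrite maxE eqxx => /esym/andP[_ /forall_inP/(_ [set j; l])].
rewrite cards2 jl => /(_ isT)/cards1P[k /setP/(_ k)].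
by rewrite !inE eqxx subUset !sub1set !inE => jk; exists k.
Qed.

(** The degrees are 1 or 2, so sum_i d_i = m + 'C(n, 2) falls short of 2 m by the
    number of light rows. *)
Lemma card_light : #|[set i | light E i]| + 'C(n, 2) = m.
Proof.
apply: (@addnI m); rewrite addnCA -maxE card_rows -sum1dep_card big_mkcond.
rewrite -big_split /= addnn -muln2.
have -> : m * 2 = \sum_(i < m) 2 by rewrite sum_nat_const card_ord.
apply: eq_bigr => i _; move: (extremal_row_size i); rewrite /light.
by case: #|_| => [|[|[|]]].
Qed.

End ExtremalRows.

(** * Adding one 2-edge inside a row *)

(** A row-degenerate 2-edge lies in no cycle of type 2.  One of type 3 would use
    a further row occupied in three columns, while outside row i only the at most
    two 1-edges of each row are occupied. *)
Lemma row_edge_augmentation E i j q :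
    ~~ has_C4 E -> #|E| = zarankiewicz m n ->
    (forall k, #|row E k| < 3) ->
    j != q -> (i, j) \notin E -> (i, q) \notin E ->
  #|E| + 1 <= limited_zarankiewicz m n.
Proof.
move=> noC4 maxE row2 jq ij iq.
set e := [set (i, j); (i, q)].
have edge_row a b p r : [set (a, b); (p, r)] = e ->
    [/\ a = i, p = i & [set b; r] = [set j; q]].
  move=> /setP/(_ _)eP.
  have := eP (a, b); have := eP (p, r); rewrite !inE !eqxx orbT /= !xpair_eqE.
  rewrite -!andb_orr => /esym/andP[/eqP pi _] /esym/andP[/eqP ai _].
  split=> //.
  by apply/setP=> x; have := eP (i, x); rewrite !inE !xpair_eqE ai pi eqxx.
have cover_e : cover [set e] = e by rewrite /cover big_set1.
rewrite -(cards1 e).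
apply: (@leq_bigmax_cond _ _
  (fun G : {set cell m n} * {set {set cell m n}} => #|G.1| + #|G.2|) (E, [set e])).
rewrite /= /limited_augmented noC4 maxE eqxx /= /has_generalized_C4 !negb_or noC4.
rewrite !andTb; apply/and3P; split.
- apply/andP; split.
    by apply/forall_inP => f /set1P->; rewrite /is_two_edge cards2 xpair_eqE eqxx jq.
  rewrite /simple_augmentation cover_e disjoint_sym disjoints_subset subUset.
  by rewrite !sub1set !inE ij iq; apply/trivIsetP => f g /set1P-> /set1P->; rewrite eqxx.
- apply/negP=> /existsP[a /existsP[b /existsP[p /existsP[r]]]].
  by case/and4P => /set1P/edge_row[-> -> _]; rewrite /nondegenerate eqxx.
- apply/negP=> /existsP[a /existsP[b /existsP[p /existsP[r /existsP[k /existsP[l]]]]]].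
  case/and5P => /set1P/edge_row[-> -> br].
  rewrite !inE orbb !negb_or => ki /andP[lb lr] /and5P[kl kb kr _ _] _.
  (* Row k would have 1-edges in the three columns l, j and q. *)
  have : #|[set l] :|: [set b; r]| <= #|row E k|.
    apply/subset_leq_card/subsetP => x; rewrite !inE.
    have inE_k y : [|| (k, y) \in E | (k, y) \in cover [set e]] -> (k, y) \in E.
      by rewrite cover_e !inE !xpair_eqE (negPf ki) orbF.
    move: kl kb kr; rewrite !inE => /inE_k kl /inE_k kb /inE_k kr.
    by case/or3P => /eqP->.
  rewrite leqNgt; apply/negP; rewrite negbK cardsU1 !inE (negPf lb) (negPf lr).
  by rewrite br cards2 jq; apply: row2.
Qed.

End Extremal.

(** * Two 2-edges always create a generalized C4 *)

Lemma ord3_cases (a b c x : 'I_3) : a != b -> c != a -> c != b ->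
  [\/ x = a, x = b | x = c].
Proof.
move=> ab ca cb.
have : x \in [:: a; b; c].
  have [|||_ ->] := @uniq_min_size _ [:: a; b; c] (enum 'I_3).
  - by rewrite /= !inE negb_or ab !(eq_sym _ c) ca cb.
  - by move=> y _; rewrite mem_enum.
  - by rewrite size_enum_ord.
  by rewrite mem_enum.
by rewrite !inE => /or3P[]/eqP->; [apply: Or31 | apply: Or32 | apply: Or33].
Qed.

Lemma ord3_third (a b : 'I_3) : exists c, (c != a) && (c != b).
Proof.
have : 0 < #|~: [set a; b]|.
  by rewrite -(ltn_add2l #|[set a; b]|) cardsC card_ord addn0 cards2; case: (_ != _).
by case/card_gt0P => c; rewrite !inE negb_or; exists c.
Qed.

Section AtMostOne.

Variables (m : nat) (E1 : {set cell m 3}) (E2 : {set {set cell m 3}}).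
Hypotheses (m_le5 : m <= 5) (maxE1 : #|E1| = m + 3).
Hypotheses (augG : limited_augmented E1 E2) (freeG : ~~ has_generalized_C4 E1 E2).

Implicit Types (e f : {set cell m 3}) (i k : 'I_m) (j l : 'I_3).

Let occ := occupied E1 E2.
(** A row is often completed by halves of 2-edges, and this is how two 2-edges
    interfere. *)
Let full k := forall l, (k, l) \in occ.

Let noC4 : ~~ has_C4 E1. Proof. by case/and4P: augG. Qed.

Lemma E1_occ x : x \in E1 -> x \in occ.
Proof. by rewrite inE => ->. Qed.

Lemma half_occ e x : e \in E2 -> x \in e -> x \in occ.
Proof. by move=> eE xe; rewrite inE; apply/orP; right; apply/bigcupP; exists e. Qed.

Lemma half_notin_E1 e x : e \in E2 -> x \in e -> x \notin E1.
Proof.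
move=> eE xe; have /and4P[_ _ _ /andP[dis _]] := augG.
have : x \in cover E2 by apply/bigcupP; exists e.
by apply: contraL => xE; rewrite (disjointFr dis xE).
Qed.

Lemma shared_half e f x : e \in E2 -> f \in E2 -> x \in e -> x \in f -> e = f.
Proof.
move=> eE fE xe xf; have /and4P[_ _ _ /andP[_ /trivIsetP tri]] := augG.
apply/eqP; apply/negPn/negP => /(tri e f eE fE) /disjointFr/(_ xe).
by rewrite xf.
Qed.

Lemma no_crossing i j k l : [set (i, j); (k, l)] \in E2 -> i != k -> j != l ->
  (i, l) \in occ -> (k, j) \notin occ.
Proof.
move=> eE ik jl il; apply/negP => kj.
have /norP[_ /norP[/negP no2 _]] := freeG; apply: no2.
apply/existsP; exists i; apply/existsP; exists j.
apply/existsP; exists k; apply/existsP; exists l.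
by apply/and4P; split=> //; apply/andP.
Qed.

(** A full row k supplies the three cells (k, l), (k, j), (k, q) of a cycle of
    type 3. *)
Lemma no_type3_full i j p q k l : [set (i, j); (p, q)] \in E2 -> j != q ->
    k != i -> k != p -> l != j -> l != q -> full k -> (i, l) \in occ ->
  (p, l) \notin occ.
Proof.
move=> eE jq ki kp lj lq fk il; apply/negP => pl.
have /norP[_ /norP[_ /negP no3]] := freeG; apply: no3.
apply/existsP; exists i; apply/existsP; exists j.
apply/existsP; exists p; apply/existsP; exists q.
apply/existsP; exists k; apply/existsP; exists l.
apply/and5P; split=> //; rewrite ?(inE, negb_or) ?ki ?kp ?lj ?lq //.
  by rewrite /= -/occ !fk il pl.
apply/implyP => /andP[/= ip _].
rewrite /= !inE !xpair_eqE !eqxx (negPf jq) (negPf lj) (negPf lq).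
by rewrite (negPf ki) (negPf kp) (negPf ip).
Qed.

Lemma joined j l : j != l -> exists k, ((k, j) \in E1) && ((k, l) \in E1).
Proof. exact: extremal_joined noC4 maxE1 j l. Qed.

(** The row k joining columns j and l by 1-edges is different from i and p, whose
    cells in column j are halves; it closes a column-degenerate cycle of type 3. *)
Lemma no_column_pair i p j l : [set (i, j); (p, j)] \in E2 -> l != j ->
  (i, l) \in occ -> (p, l) \notin occ.
Proof.
move=> eE lj il; apply/negP => pl.
have /norP[_ /norP[_ /negP no3]] := freeG; apply: no3.
have [k /andP[kl kj]] := joined lj.
have ki : k != i.
  apply: contraNneq (half_notin_E1 eE (set21 _ _)) => <-; exact: kj.
have kp : k != p.
  apply: contraNneq (half_notin_E1 eE (set22 _ _)) => <-; exact: kj.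
apply/existsP; exists i; apply/existsP; exists j.
apply/existsP; exists p; apply/existsP; exists j.
apply/existsP; exists k; apply/existsP; exists l.
apply/and5P; split=> //; rewrite ?(inE, negb_or) ?ki ?kp ?lj //.
  by rewrite /= -/occ il pl !E1_occ.
by rewrite /nondegenerate eqxx andbF.
Qed.

Lemma row_size i : 0 < #|row E1 i| < 3.
Proof. exact: extremal_row_size noC4 maxE1 i. Qed.

Lemma row_nonempty i : exists j, (i, j) \in E1.
Proof.
have /andP[/card_gt0P[j]] := row_size i.
by rewrite inE; exists j.
Qed.

(** Every row of E1 has a 1-edge. *)
Lemma in_third_column i a b c : a != b -> c != a -> c != b ->
  (i, a) \notin E1 -> (i, b) \notin E1 -> (i, c) \in E1.
Proof.
move=> ab ca cb /negP ia /negP ib; have [x ix] := row_nonempty i.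
by have [xE|xE|<-//] := ord3_cases x ab ca cb; rewrite xE in ix.
Qed.

Lemma empty_in_pair i a b c : a != b -> (i, a) \notin E1 -> (i, b) \notin E1 ->
  (i, c) \notin E1 -> c \in [set a; b].
Proof.
move=> ab ia ib; apply: contraNT; rewrite !inE negb_or => /andP[ca cb].
exact: in_third_column ab ca cb ia ib.
Qed.

Lemma heavy_row i c j : ~~ light E1 i -> (i, c) \notin E1 -> j != c -> (i, j) \in E1.
Proof.
move=> hi ic jc.
have r2 : #|row E1 i| = 2.
  by move: hi (row_size i); rewrite /light; case: #|_| => [|[|[|]]].
have /setP/(_ j) : row E1 i = [set~ c].
  apply/eqP; rewrite eqEcard r2 cardsC1 card_ord leqnn andbT.
  by apply/subsetP => x; rewrite !inE; apply: contraTneq => ->.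
by rewrite !inE jc.
Qed.

Lemma full_heavy i c : ~~ light E1 i -> (i, c) \notin E1 -> (i, c) \in occ -> full i.
Proof.
move=> hi icE ic l; have [->//|lc] := eqVneq l c.
exact/E1_occ/(heavy_row hi icE).
Qed.

Lemma full_of_two_empty i a b : a != b -> (i, a) \notin E1 -> (i, b) \notin E1 ->
  (i, a) \in occ -> (i, b) \in occ -> full i.
Proof.
move=> ab iaE ibE ia ib l; have [->//|la] := eqVneq l a; have [->//|lb] := eqVneq l b.
exact/E1_occ/(in_third_column ab).
Qed.

Definition mixed e h c u j :=
  [/\ e = [set (h, c); (u, j)], ~~ light E1 h & light E1 u].

Definition inside e u j q := [/\ e = [set (u, j); (u, q)], light E1 u & j != q].

Definition across e u j v l :=
  [/\ e = [set (u, j); (v, l)], light E1 u, light E1 v & u != v].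

(** Two heavy halves in different columns lie in different rows i, p, and the
    opposite corners are 1-edges, as each of these rows has a single empty cell:
    this is a cycle of type 2.  In one column they contradict
    [no_column_pair]. *)
Lemma two_edge_cases e : e \in E2 ->
  [\/ exists h c u j, mixed e h c u j,
      exists u j q, inside e u j q
    | exists u j v l, across e u j v l].
Proof.
move=> eE; have /and4P[_ _ /forall_inP/(_ e eE)/cards2P[x [y [xy eq_e]]] _] := augG.
case: x y xy eq_e => [i j] [p q] xy eq_e.
have eE' := eE; rewrite eq_e in eE'.
have ijE := half_notin_E1 eE' (set21 _ _).
have pqE := half_notin_E1 eE' (set22 _ _).
have [li|hi] := boolP (light E1 i); have [lp|hp] := boolP (light E1 p).
- have [ip|ip] := eqVneq i p; last by apply: Or33; exists i, j, p, q.
  apply: Or32; exists i, j, q; split=> //; first by rewrite eq_e ip.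
  by apply: contraNneq xy => ->; rewrite ip.
- by apply: Or31; exists p, q, i, j; split=> //; rewrite setUC.
- by apply: Or31; exists i, j, p, q; split.
have [jq|jq] := eqVneq j q.
  (* Any column other than j will do. *)
  have [l /andP[lj _]] := ord3_third j j.
  rewrite -jq in eE' pqE; have := no_column_pair eE' lj (E1_occ (heavy_row hi ijE lj)).
  by rewrite E1_occ // (heavy_row hp pqE).
have [ip|ip] := eqVneq i p.
  by move: pqE; rewrite -ip (heavy_row hi ijE) // eq_sym.
have qj : q != j by rewrite eq_sym.
have := no_crossing eE' ip jq (E1_occ (heavy_row hi ijE qj)).
by rewrite E1_occ // (heavy_row hp pqE).
Qed.

(** If c = j the 1-edge of the light row would share its column with a 1-edge of
    row h, against [no_column_pair].  So c and j differ, (h, j) is a 1-edge, and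
    an occupied (u, c) would complete a cycle of type 2. *)
Lemma mixed_shape e h c u j : e \in E2 -> mixed e h c u j ->
  [/\ c != j, (u, c) \notin occ & full h].
Proof.
move=> eE [eq_e hh lu]; rewrite eq_e in eE.
have hcE := half_notin_E1 eE (set21 _ _); have ujE := half_notin_E1 eE (set22 _ _).
have hu : h != u by apply: contraNneq hh => ->.
have cj : c != j.
  apply/eqP => cj; rewrite cj in eE hcE; have [l ul] := row_nonempty u.
  have lj : l != j by apply: contraNneq ujE => <-.
  by have := no_column_pair eE lj (E1_occ (heavy_row hh hcE lj)); rewrite E1_occ.
split=> //; last exact: full_heavy hh hcE (half_occ eE (set21 _ _)).
have jc : j != c by rewrite eq_sym.
exact: no_crossing eE hu cj (E1_occ (heavy_row hh hcE jc)).
Qed.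

(** The row h' of f is full.  If it differs from h it kills e: the 1-edge of the
    light row u is in the column l other than c and j, and (h, l) is a 1-edge as
    well. *)
Lemma mixed_unique e f h c u j h' c' u' j' : e \in E2 -> f \in E2 ->
  mixed e h c u j -> mixed f h' c' u' j' -> e = f.
Proof.
move=> eE fE Me Mf; have [cj ucN _] := mixed_shape eE Me.
have [_ _ fh'] := mixed_shape fE Mf.
case: Me Mf => eq_e hh lu [eq_f hh' lu'].
have hce : (h, c) \in e by rewrite eq_e set21.
have hcf : (h', c') \in f by rewrite eq_f set21.
have [hh'E|h'h] := eqVneq h' h.
  apply: (shared_half eE fE hce); suff <- : c' = c by rewrite -hh'E.
  apply/eqP; apply: contraNT (half_notin_E1 fE hcf); rewrite hh'E.
  exact: heavy_row (half_notin_E1 eE hce).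
have h'u : h' != u by apply: contraNneq hh' => ->.
have ucE : (u, c) \notin E1 by apply: contra ucN; apply: E1_occ.
have uje : (u, j) \in e by rewrite eq_e set22.
have [l /andP[lc lj]] := ord3_third c j.
have ul := in_third_column cj lc lj ucE (half_notin_E1 eE uje).
have hl := heavy_row hh (half_notin_E1 eE hce) lc.
have eE' := eE; rewrite eq_e in eE'.
by have := no_type3_full eE' cj h'h h'u lc lj fh' (E1_occ hl); rewrite E1_occ.
Qed.

(** The third column holds the only 1-edge of row u. *)
Lemma inside_blocked e u j q k : e \in E2 -> inside e u j q -> k != u -> ~ full k.
Proof.
move=> eE [eq_e lu jq] ku fk.
have [l /andP[lj lq]] := ord3_third j q.
have uj : (u, j) \in e by rewrite eq_e set21.
have uq : (u, q) \in e by rewrite eq_e set22.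
have ul := in_third_column jq lj lq (half_notin_E1 eE uj) (half_notin_E1 eE uq).
rewrite eq_e in eE.
by have := no_type3_full eE jq ku ku lj lq fk (E1_occ ul); rewrite E1_occ.
Qed.

Lemma mixed_not_inside e f h c u j w a b : e \in E2 -> f \in E2 ->
  mixed e h c u j -> inside f w a b -> False.
Proof.
move=> eE fE Me If; have [_ _ fh] := mixed_shape eE Me.
apply: (inside_blocked fE If _ fh); apply/eqP => hw.
by case: Me If => _ hh _ [_ lw _]; rewrite hw lw in hh.
Qed.

(** There are m - 3 light rows, hence at most two; this is where m <= 5 is used. *)
Lemma light_rows u v w : light E1 u -> light E1 v -> u != v -> light E1 w ->
  w = u \/ w = v.
Proof.
move=> lu lv uv lw.
have sub : [set u; v] \subset [set i | light E1 i].
  by rewrite subUset !sub1set !inE lu lv.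
have /eqP eq_uv : [set u; v] == [set i | light E1 i].
  rewrite eqEcard sub cards2 uv -(leq_add2r 'C(3, 2)).
  by rewrite (card_light noC4 maxE1).
have : w \in [set u; v] by rewrite eq_uv inE.
by rewrite !inE => /orP[]/eqP; [left|right].
Qed.

Lemma inside_meets e f u j q l : e \in E2 -> f \in E2 -> inside e u j q ->
  (u, l) \in f -> e = f.
Proof.
move=> eE fE [eq_e _ jq] ulf; apply: (shared_half eE fE _ ulf).
have uj : (u, j) \in e by rewrite eq_e set21.
have uq : (u, q) \in e by rewrite eq_e set22.
have := empty_in_pair jq (half_notin_E1 eE uj) (half_notin_E1 eE uq) (half_notin_E1 fE ulf).
by rewrite !inE => /orP[]/eqP->.
Qed.

Lemma inside_unique e f u j q w a b : e \in E2 -> f \in E2 ->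
  inside e u j q -> inside f w a b -> e = f.
Proof.
move=> eE fE Ie If; have [eq_f lw ab] := If.
have wa : (w, a) \in f by rewrite eq_f set21.
have wb : (w, b) \in f by rewrite eq_f set22.
have [uw|uw] := eqVneq w u; first by rewrite uw in wa; apply: inside_meets Ie wa.
case: (inside_blocked eE Ie uw).
exact: full_of_two_empty ab (half_notin_E1 fE wa) (half_notin_E1 fE wb)
  (half_occ fE wa) (half_occ fE wb).
Qed.

Lemma across_meets f u j v l w : across f u j v l -> light E1 w ->
  exists x, (w, x) \in f.
Proof.
move=> [eq_f lu lv uv] lw.
by have [->|->] := light_rows lu lv uv lw; [exists j | exists l];
  rewrite eq_f ?set21 ?set22.
Qed.

(** The empty cells of row u are (u, j), which belongs to e, and (u, c), which is
    unoccupied; f needs one of them. *)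
Lemma mixed_not_across e f h c u j u' j' v l : e \in E2 -> f \in E2 ->
  mixed e h c u j -> across f u' j' v l -> False.
Proof.
move=> eE fE Me Af; have [cj ucN _] := mixed_shape eE Me.
case: Me => eq_e hh lu; have [x uxf] := across_meets Af lu.
have uje : (u, j) \in e by rewrite eq_e set22.
have ucE : (u, c) \notin E1 by apply: contra ucN; apply: E1_occ.
have := empty_in_pair cj ucE (half_notin_E1 eE uje) (half_notin_E1 fE uxf).
rewrite !inE => /orP[]/eqP xE; rewrite xE in uxf.
  by rewrite (half_occ fE uxf) in ucN.
have ef := shared_half eE fE uje uxf.
have /setP/(_ (h, c)) := ef; case: Af => -> lu' lv _; rewrite eq_e !inE eqxx.
by rewrite !xpair_eqE => /esym/orP[]/andP[/eqP hE _]; rewrite hE ?lu' ?lv in hh.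
Qed.

(** Disjoint 2-edges across the light rows use all four empty cells there, so both
    light rows are full; e then violates [no_crossing] if its columns differ and
    [no_column_pair] otherwise. *)
Lemma across_unique e f u j v l u' j' v' l' : e \in E2 -> f \in E2 ->
  across e u j v l -> across f u' j' v' l' -> e = f.
Proof.
move=> eE fE [eq_e lu lv uv] Af; apply/eqP/negPn/negP => ef.
have [a uaf] := across_meets Af lu; have [b vbf] := across_meets Af lv.
have uje : (u, j) \in e by rewrite eq_e set21.
have vle : (v, l) \in e by rewrite eq_e set22.
have meet x : x \in e -> x \in f -> False.
  by move=> xe xf; rewrite (shared_half eE fE xe xf) eqxx in ef.
have ja : j != a by apply/eqP => jaE; apply: (meet _ uje); rewrite jaE.
have lb : l != b by apply/eqP => lbE; apply: (meet _ vle); rewrite lbE.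
have fu : full u := full_of_two_empty ja (half_notin_E1 eE uje) (half_notin_E1 fE uaf)
  (half_occ eE uje) (half_occ fE uaf).
have fv : full v := full_of_two_empty lb (half_notin_E1 eE vle) (half_notin_E1 fE vbf)
  (half_occ eE vle) (half_occ fE vbf).
rewrite eq_e in eE.
have [jl|jl] := eqVneq j l; last by have := no_crossing eE uv jl (fu l); rewrite fv.
rewrite -jl in eE; rewrite eq_sym in ja.
by have := no_column_pair eE ja (fu a); rewrite fv.
Qed.

Lemma card_E2_le1 : #|E2| <= 1.
Proof.
apply/card_le1_eqP => f e fE eE.
have [[h [c [u [j Me]]]]|[u [j [q Ie]]]|[u [j [v [l Ae]]]]] := two_edge_cases eE;
have [[h' [c' [u' [j' Mf]]]]|[u' [j' [q' If]]]|[u' [j' [v' [l' Af]]]]] :=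
  two_edge_cases fE.
- exact: mixed_unique Me Mf.
- by case: (mixed_not_inside eE fE Me If).
- by case: (mixed_not_across eE fE Me Af).
- by case: (mixed_not_inside fE eE Mf Ie).
- exact: inside_unique Ie If.
- by have [_ lu _] := Ie; have [x] := across_meets Af lu; apply: inside_meets Ie.
- by case: (mixed_not_across fE eE Mf Ae).
- have [_ lu _] := If; have [x ue] := across_meets Ae lu.
  by apply/esym/(inside_meets fE eE If ue).
- exact: across_unique Ae Af.
Qed.

End AtMostOne.

(** * The five by three case *)

(** Rows 0, 1, 2 miss exactly the column of the same number, so that each joins
    its own pair of columns; rows 3 and 4 meet column 0 only. *)
Definition extremal_5_3 : {set cell 5 3} :=
  [set x : cell 5 3 | if x.1 < 3 then x.1 != x.2 :> nat else x.2 == 0 :> nat].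

Lemma extremal_5_3_C4_free : ~~ has_C4 extremal_5_3.
Proof.
apply/existsP=> -[i /existsP[k /existsP[j /existsP[l]]]].
rewrite !inE -!val_eqE /=; have := ltn_ord i; have := ltn_ord j.
have := ltn_ord k; have := ltn_ord l.
by case: ifP; case: ifP; lia.
Qed.

Lemma card_row_extremal_5_3 i : #|row extremal_5_3 i| = if i < 3 then 2 else 1.
Proof.
have [i3|i3] := ifP.
  have -> : row extremal_5_3 i = [set~ Ordinal i3].
    by apply/setP => j; rewrite !inE /= i3 -val_eqE eq_sym.
  by rewrite cardsC1 card_ord.
have -> : row extremal_5_3 i = [set ord0].
  by apply/setP => j; rewrite !inE /= i3.
exact: cards1.
Qed.

Lemma card_extremal_5_3 : #|extremal_5_3| = 8.
Proof.
rewrite card_rows (eq_bigr _ (fun i _ => card_row_extremal_5_3 i)).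
by rewrite !big_ord_recl big_ord0.
Qed.

Lemma zarankiewicz_5_3 : zarankiewicz 5 3 = 8.
Proof.
apply/eqP; rewrite eqn_leq -{2}card_extremal_5_3.
rewrite (@leq_bigmax_cond _ _ (fun E : {set cell 5 3} => #|E|)) ?extremal_5_3_C4_free //.
rewrite andbT; apply/bigmax_leqP => E /leqif_card_C4_free[leE _].
exact: leE.
Qed.

Theorem theorem4p3 : limited_zarankiewicz 5 3 = 9.
Proof.
apply/eqP; rewrite eqn_leq; apply/andP; split.
  apply/bigmax_leqP => -[E1 E2] /= /andP[augG freeG].
  have /and4P[_ /eqP maxE _ _] := augG; rewrite zarankiewicz_5_3 in maxE.
  by rewrite maxE (leq_add2l 8 _ 1) (card_E2_le1 _ _ augG freeG).
rewrite -[9]/(8 + 1) -card_extremal_5_3.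
(* Row 4 has its only 1-edge in column 0, so columns 1 and 2 are free. *)
apply: (@row_edge_augmentation _ _ _ ord_max (inord 1) ord_max).
- exact: extremal_5_3_C4_free.
- by rewrite zarankiewicz_5_3 card_extremal_5_3.
- by move=> k; rewrite card_row_extremal_5_3; case: ifP.
- by rewrite -val_eqE /= inordK.
- by rewrite inE /= inordK.
- by rewrite inE.
Qed.
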